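(* Let $\mathcal{A}$ be a finite alphabet and let $\Theta_1:\mathcal{A}^*\to\mathcal{A}^*$ be an involutive antimorphism. Let $\mathbf{u}\in\mathcal{A}^{\mathbb{N}}$ be a recurrent infinite word such that $D_{\Theta_1}(\mathbf{u})<+\infty$. Then there exist a finite alphabet $\mathcal{B}$, an involutive antimorphism $\Theta_2:\mathcal{B}^*\to\mathcal{B}^*$, a morphism $\varphi:\mathcal{B}^*\to\mathcal{A}^*$ and a recurrent infinite word $\mathbf{v}\in\mathcal{B}^{\mathbb{N}}$ such that $\mathbf{u}=\varphi(\mathbf{v})$ and $\mathbf{v}$ is $\Theta_2$-rich.
   Context: An involutive antimorphism on $\mathcal{A}^*$ is a map $\Theta:\mathcal{A}^*\to\mathcal{A}^*$ with $\Theta^2=\mathrm{Id}$ and $\Theta(uv)=\Theta(v)\Theta(u)$ for all $u,v\in\mathcal{A}^*$. A word $w$ is a $\Theta$-palindrome if $\Theta(w)=w$ (the empty word is one). For a finite word $w$, $\mathrm{Pal}_\Theta(w)$ is the set of distinct $\Theta$-palindromes occurring as factors of $w$ (including the empty word), and $G_\Theta(w)$ is the number of sets $\{a,\Theta(a)\}$ where $a$ is a letter occurring in $w$ with $a\neq\Theta(a)$. The $\Theta$-palindromic defect of a finite word $w$ is $D_\Theta(w)=|w|+1-G_\Theta(w)-\#\mathrm{Pal}_\Theta(w)$ (always $\ge 0$), and for an infinite word $\mathbf{u}$, $D_\Theta(\mathbf{u})=\sup\{D_\Theta(w): w \text{ a factor of } \mathbf{u}\}$. A finite word $w$ is $\Theta$-rich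 if $D_\Theta(w)=0$; an infinite word is $\Theta$-rich if all its factors are $\Theta$-rich. An infinite word is recurrent if every factor occurs in it infinitely many times. For a morphism $\varphi$ and infinite word $\mathbf{v}=v_0v_1\cdots$, $\varphi(\mathbf{v})=\varphi(v_0)\varphi(v_1)\cdots$. *)

(* Defs.v *)
From mathcomp Require Import all_boot all_order all_algebra.
Set Implicit Arguments. Unset Strict Implicit. Unset Printing Implicit Defensive.
Import GRing.Theory Num.Theory.

Section Words.
Variable A : finType.

Definition involutive_antimorphism (Th : seq A -> seq A) : Prop :=
  (forall w, Th (Th w) = w) /\ (forall u v, Th (u ++ v) = Th v ++ Th u).

Definition is_pal (Th : seq A -> seq A) (w : seq A) : bool := Th w == w.

Definition factors (w : seq A) : seq (seq A) :=
  [seq take j (drop i w) | i <- iota 0 (size w).+1, j <- iota 0 (size w - i).+1].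

Definition npal (Th : seq A -> seq A) (w : seq A) : nat :=
  size (undup [seq x <- factors w | is_pal Th x]).

Definition pairset (Th : seq A -> seq A) (a : A) : {set A} :=
  [set b | (b == a) || ([:: b] == Th [:: a])].

Definition Gth (Th : seq A -> seq A) (w : seq A) : nat :=
  size (undup [seq pairset Th a | a <- w & [:: a] != Th [:: a]]).

Definition defect (Th : seq A -> seq A) (w : seq A) : int :=
  ((size w + 1)%:Z - (Gth Th w)%:Z - (npal Th w)%:Z)%R.

Definition occurs_at (u : nat -> A) (w : seq A) (i : nat) : Prop :=
  w = [seq u (i + k) | k <- iota 0 (size w)].

Definition factor_of (u : nat -> A) (w : seq A) : Prop := exists i, occurs_at u w i.

Definition recurrent (u : nat -> A) : Prop :=
  forall w i, occurs_at u w i -> forall N, exists j, N <= j /\ occurs_at u w j.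

Definition finite_defect (Th : seq A -> seq A) (u : nat -> A) : Prop :=
  exists B : int, forall w, factor_of u w -> (defect Th w <= B)%R.

Definition rich (Th : seq A -> seq A) (u : nat -> A) : Prop :=
  forall w, factor_of u w -> defect Th w = 0%R.

End Words.

Definition morphism (B A : Type) (phi : seq B -> seq A) : Prop :=
  forall x y, phi (x ++ y) = phi x ++ phi y.

Definition img_prefix (B A : Type) (phi : seq B -> seq A) (v : nat -> B) (m : nat) : seq A :=
  flatten [seq phi [:: v i] | i <- iota 0 m].

(* u = phi(v): phi(v) is an infinite word equal to u *)
Definition image_eq (B A : Type) (phi : seq B -> seq A) (v : nat -> B) (u : nat -> A) : Prop :=
  (forall m, [seq u k | k <- iota 0 (size (img_prefix phi v m))] = img_prefix phi v m) /\
  (forall n, exists m, n <= size (img_prefix phi v m)).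

(* Main.v *)
(* Write an antimorphism as reversal composed with a letter involution.  Adding
   a letter to a word never lowers the defect, and keeps it exactly when the
   letter opens a new pair {a, Theta a} or ends a palindromic suffix that did
   not occur before.  Let a factor of [u] of length [n] have maximal defect:
   from each of its occurrences on, every added letter is of one of these two
   kinds.  Recode [u] by its factors of length [n + 1], projecting each block to
   its first letter; the mirror image permutes the blocks, and maximality makes
   the recoded word rich. *)
Require Import Defs.
From mathcomp Require Import all_boot all_order all_algebra.
From mathcomp Require Import zify.
From Stdlib Require Import Classical.
Set Implicit Arguments. Unset Strict Implicit. Unset Printing Implicit Defensive.
Import Order.TTheory GRing.Theory Num.Theory.

(** * Antimorphisms as letterwise involution followed by reversal *)

Definition mirror (T : Type) (th : T -> T) (w : seq T) : seq T := rev (map th w).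

Lemma mirror_cat (T : Type) (th : T -> T) (w z : seq T) :
  mirror th (w ++ z) = mirror th z ++ mirror th w.
Proof. by rewrite /mirror map_cat rev_cat. Qed.

Lemma mirrorK (T : Type) (th : T -> T) :
  involutive th -> involutive (mirror th).
Proof. by move=> thK w; rewrite /mirror map_rev revK mapK. Qed.

Lemma mirror_antimorphism (A : finType) (th : A -> A) :
  involutive th -> involutive_antimorphism (mirror th).
Proof. by move=> thK; split; [exact: mirrorK | exact: mirror_cat]. Qed.

(** No letter has an empty image, so [Th] never shortens a word. Applied to [Th [:: a]], whose image
    is [[:: a]], this forces letters to go to letters. *)
Lemma antimorphismE (A : finType) (Th : seq A -> seq A) :
  involutive_antimorphism Th ->
  exists th : A -> A, involutive th /\ Th =1 mirror th.
Proof.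
case=> ThK ThM.
have Th0 : Th [::] = [::].
  have /(congr1 size) := ThM [::] [::]; rewrite size_cat /=.
  by move=> H; apply: size0nil; lia.
have Th_pos a : 0 < size (Th [:: a]).
  by case E: (Th [:: a]) => [|//]; have := ThK [:: a]; rewrite E Th0.
have Th_size w : size w <= size (Th w).
  elim: w => // a w IHw; rewrite -cat1s ThM !size_cat addnC.
  by rewrite leq_add.
have Th1 a : size (Th [:: a]) = 1.
  have := Th_size (Th [:: a]); rewrite ThK /=.
  by have := Th_pos a; lia.
pose th a := head a (Th [:: a]).
have ThE a : Th [:: a] = [:: th a].
  by rewrite /th; case: (Th [:: a]) (Th1 a) => [|b [|]].
exists th; split=> [a|w]; first by have := ThK [:: a]; rewrite !ThE => -[].
elim: w => // a w IHw.
by rewrite -cat1s ThM IHw ThE mirror_cat.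
Qed.

(** * Effect on the defect of appending one letter *)

Lemma factorsE (A : finType) (w x : seq A) : (x \in factors w) = infix x w.
Proof.
apply/allpairsPdep/infixP => [[i [j [_ _ ->]]]|[s [s' ->]]].
  by exists (take i w), (drop j (drop i w)); rewrite !cat_take_drop.
exists (size s), (size x); rewrite !mem_iota !size_cat /=.
by rewrite drop_size_cat // take_size_cat //; split=> //; lia.
Qed.

Definition palset (A : finType) (th : A -> A) (w : seq A) : seq (seq A) :=
  undup [seq x <- factors w | is_pal (mirror th) x].

Lemma mem_palset (A : finType) (th : A -> A) (w x : seq A) :
  (x \in palset th w) = (mirror th x == x) && infix x w.
Proof. by rewrite mem_undup mem_filter factorsE. Qed.

Lemma size_eq_mem (T : eqType) (s t : seq T) :
  uniq s -> uniq t -> s =i t -> size s = size t.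
Proof. by move=> us ut st; apply: perm_size; apply: uniq_perm. Qed.

Definition new_pal (A : finType) (th : A -> A) (w : seq A) (a : A) : bool :=
  has (fun p => ~~ infix p w) (palset th (rcons w a)).

Lemma new_palP (A : finType) (th : A -> A) (w : seq A) (a : A) :
  reflect (exists p, [/\ mirror th p = p, suffix p (rcons w a) & ~~ infix p w])
          (new_pal th w a).
Proof.
apply: (iffP hasP) => [[p pw np]|[p [pp sp np]]]; exists p => //.
  move: pw; rewrite mem_palset infix_rconsl => /andP[/eqP pp].
  by rewrite (negbTE np) orbF.
by rewrite mem_palset pp eqxx infix_rconsl sp.
Qed.

Lemma npal_rcons (A : finType) (th : A -> A) (w : seq A) (a : A) :
  npal (mirror th) (rcons w a) = npal (mirror th) w + new_pal th w a.
Proof.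
rewrite -[npal _ _]/(size (palset th _)) -[npal _ w]/(size (palset th _)).
have uP z : uniq (palset th z) by exact: undup_uniq.
case: new_palP => [[p [pp sp np]]|nonew] /=; last first.
  rewrite addn0; apply: size_eq_mem => // x; rewrite !mem_palset infix_rconsl.
  case: eqP => //= px; case: (boolP (infix x w)); rewrite ?orbT ?orbF // => nx.
  by apply/negP => sx; apply: nonew; exists x.
rewrite addn1 -[_.+1]/(size (p :: palset th w)); apply: size_eq_mem => //.
  by rewrite /= uP mem_palset (negbTE np) andbF.
move=> x; rewrite inE !mem_palset infix_rconsl.
case: (eqVneq x p) => [->|xp] /=; first by rewrite pp eqxx sp.
case: eqP => //= px; apply/orb_idl => sx.
(* Of two palindromic suffixes the shorter is also a prefix of the longer. *)
have short q r : mirror th q = q -> mirror th r = r -> q != r ->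
    size q <= size r -> suffix q (rcons w a) -> suffix r (rcons w a) ->
    infix q w.
  move=> qq rr qr sqr sq sr.
  have /suffixP[s rE] : suffix q r.
    move: sq sr; rewrite !suffixE => /eqP sq /eqP sr.
    have sl : size r <= size (rcons w a).
      by rewrite -sr size_drop leq_subr.
    apply/eqP; apply: etrans sq; rewrite -{2}sr drop_drop.
    by congr drop; rewrite addnC addnBA // subnK.
  have rE' : r = q ++ mirror th s by rewrite -{1}rr rE mirror_cat qq.
  case/lastP: (mirror th s) rE' => [|s' b] rE'.
    by rewrite rE' cats0 eqxx in qr.
  move: sr; rewrite rE' -rcons_cat suffix_rcons => /andP[_].
  exact/infix_suffix_trans/prefix_infix.
case/orP: (leq_total (size x) (size p)) => xp'; first exact: (short x p).
by case/negP: np; apply: (short p x); rewrite // eq_sym.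
Qed.

(** Exactly the case in which appending [a] adds a pair to those counted by [Gth]. *)
Definition fresh (A : finType) (th : A -> A) (w : seq A) (a : A) : bool :=
  [&& th a != a, a \notin w & th a \notin w].

Lemma mem_pairset (A : finType) (th : A -> A) (a b : A) :
  (b \in pairset (mirror th) a) = (b == a) || (b == th a).
Proof. by rewrite inE /mirror /= /rev /= eqseq_cons andbT. Qed.

Lemma pairset_mirror (A : finType) (th : A -> A) (a : A) : involutive th ->
  pairset (mirror th) (th a) = pairset (mirror th) a.
Proof. by move=> thK; apply/setP => b; rewrite !mem_pairset thK orbC. Qed.

Definition pairs (A : finType) (th : A -> A) (w : seq A) : seq {set A} :=
  [seq pairset (mirror th) a | a <- w & [:: a] != mirror th [:: a]].

Lemma mem_pairs (A : finType) (th : A -> A) (w : seq A) (a : A) :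
  involutive th -> th a != a ->
  (pairset (mirror th) a \in pairs th w) = (a \in w) || (th a \in w).
Proof.
move=> thK tha; apply/mapP/orP => [[b]|].
  rewrite mem_filter => /andP[_ bw] /setP/(_ a).
  rewrite !mem_pairset eqxx /= => /esym/orP[/eqP->|/eqP->]; first by left.
  by right; rewrite thK.
have np b : ([:: b] != mirror th [:: b]) = (th b != b).
  by rewrite /mirror /= /rev /= eqseq_cons andbT eq_sym.
case=> [aw|taw]; [exists a | exists (th a)] => //.
- by rewrite mem_filter np tha.
- by rewrite mem_filter np thK eq_sym tha.
- by rewrite pairset_mirror.
Qed.

Lemma Gth_rcons (A : finType) (th : A -> A) (w : seq A) (a : A) :
  involutive th ->
  Gth (mirror th) (rcons w a) = Gth (mirror th) w + fresh th w a.
Proof.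
move=> thK; rewrite /Gth filter_rcons.
have -> : ([:: a] != mirror th [:: a]) = (th a != a).
  by rewrite /mirror /= /rev /= eqseq_cons andbT eq_sym.
rewrite /fresh; case: (boolP (th a == a)) => [_|tha] /=; first by rewrite addn0.
rewrite -negb_or -mem_pairs // map_rcons.
have -> : size (undup (rcons (pairs th w) (pairset (mirror th) a))) =
    size (undup (pairset (mirror th) a :: pairs th w)).
  apply: size_eq_mem; rewrite ?undup_uniq // => x.
  by rewrite !mem_undup mem_rcons.
by rewrite /=; case: ifP => _ /=; rewrite ?addn0 ?addn1.
Qed.

(** A nonempty palindromic suffix ending in [a] starts with [th a]: either it is [[:: a]], against
    [th a != a], or [th a] already occurs in [w]. The two gains thus exclude each other, and the
    defect cannot drop. *)
Lemma fresh_new_pal (A : finType) (th : A -> A) (w : seq A) (a : A) :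
  fresh th w a -> ~~ new_pal th w a.
Proof.
case/and3P=> tha aw taw; apply/new_palP => -[p [pp sp /negP[]]].
case/lastP: p pp sp => [|p b]; first by rewrite infix0s.
rewrite suffix_rcons -cats1 mirror_cat => pp /andP[/eqP ba sp].
case: p pp sp => [|c p]; rewrite {}ba /=.
  by case=> /eqP; rewrite (negbTE tha).
case=> ca _ /suffixP[s wE]; case/negP: taw.
by rewrite wE mem_cat ca inE eqxx orbT.
Qed.

Lemma defect_rcons (A : finType) (th : A -> A) (w : seq A) (a : A) :
  involutive th ->
  (defect (mirror th) (rcons w a) =
   defect (mirror th) w + (~~ (fresh th w a || new_pal th w a))%:Z)%R.
Proof.
move=> thK; rewrite /defect size_rcons npal_rcons Gth_rcons //.
case: (boolP (fresh _ _ _)) => [/fresh_new_pal/negbTE->|_] /=; first by lia.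
by case: (new_pal _ _ _) => /=; lia.
Qed.

Lemma defect_nil (A : finType) (th : A -> A) : defect (mirror th) [::] = 0%R.
Proof. by []. Qed.

(** * Invariance under the mirror image and monotonicity *)

Lemma infix_mirror (A : finType) (th : A -> A) (x w : seq A) :
  involutive th -> infix x (mirror th w) = infix (mirror th x) w.
Proof.
move=> thK.
have H z y : infix z y -> infix (mirror th z) (mirror th y).
  move/infixP=> [s [s' ->]]; rewrite !mirror_cat -catA.
  by apply/infixP; exists (mirror th s'), (mirror th s).
by apply/idP/idP => /H; rewrite mirrorK.
Qed.

Lemma defect_mirror (A : finType) (th : A -> A) (w : seq A) :
  involutive th -> defect (mirror th) (mirror th w) = defect (mirror th) w.
Proof.
move=> thK; rewrite /defect.
have -> : size (mirror th w) = size w by rewrite size_rev size_map.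
have -> : npal (mirror th) (mirror th w) = npal (mirror th) w.
  apply: (@size_eq_mem _ (palset th _) (palset th w)); rewrite ?undup_uniq //.
  by move=> x; rewrite !mem_palset infix_mirror //; case: eqP => //= ->.
suff -> : Gth (mirror th) (mirror th w) = Gth (mirror th) w by [].
apply: (@size_eq_mem _ (undup (pairs th _)) (undup (pairs th w)));
  rewrite ?undup_uniq // => S; rewrite !mem_undup.
have mem_m a : (a \in mirror th w) = (th a \in w).
  by rewrite mem_rev -{1}(thK a) mem_map //; exact: inv_inj.
have sub z y : {in z, forall a, (a \in y) || (th a \in y)} ->
    S \in pairs th z -> S \in pairs th y.
  move=> zy /mapP[a]; rewrite mem_filter => /andP[np az] ->.
  rewrite mem_pairs ?zy // eq_sym.
  by move: np; rewrite /mirror /= /rev /= eqseq_cons andbT.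
apply/idP/idP; apply: sub => a; rewrite !mem_m ?thK => ->; by rewrite orbT.
Qed.

Lemma defect_catl (A : finType) (th : A -> A) (w z : seq A) :
  involutive th -> (defect (mirror th) w <= defect (mirror th) (w ++ z))%R.
Proof.
move=> thK; elim/last_ind: z => [|z a IHz]; first by rewrite cats0.
by rewrite -rcons_cat defect_rcons //; apply: le_trans IHz _; lia.
Qed.

(** * Words read off an infinite word *)

Definition word (T : Type) (u : nat -> T) (i m : nat) : seq T :=
  [seq u (i + k) | k <- iota 0 m].

Lemma size_word (T : Type) (u : nat -> T) (i m : nat) : size (word u i m) = m.
Proof. by rewrite size_map size_iota. Qed.

Lemma nth_word (T : Type) (x : T) (u : nat -> T) (i m k : nat) :
  k < m -> nth x (word u i m) k = u (i + k).
Proof. by move=> km; rewrite (nth_map 0) ?size_iota // nth_iota. Qed.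

Lemma word_cat (T : Type) (u : nat -> T) (i m k : nat) :
  word u i (m + k) = word u i m ++ word u (i + m) k.
Proof.
rewrite /word iotaD map_cat add0n -{2}[m]addn0 iotaDl; congr cat.
by rewrite -map_comp; apply: eq_map => l /=; rewrite addnA.
Qed.

Lemma word_rcons (T : Type) (u : nat -> T) (i m : nat) :
  word u i m.+1 = rcons (word u i m) (u (i + m)).
Proof. by rewrite -addn1 word_cat cats1 /= addn0. Qed.

(** Turns palindromicity into equations between positions, so that later steps reduce to linear
    arithmetic on indices. *)
Lemma word_mirrorP (T : Type) (th : T -> T) (u v : nat -> T) (i j m : nat) :
  mirror th (word u i m) = word v j m <->
  (forall k, k < m -> th (u (i + (m.-1 - k))) = v (j + k)).
Proof.
have nthm k : k < m ->
    nth (v 0) (mirror th (word u i m)) k = th (u (i + (m.-1 - k))).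
  move=> km; rewrite nth_rev size_map size_word //.
  rewrite (nth_map (u 0)) ?size_word ?nth_word; try lia.
  by congr (th (u _)); lia.
split=> [E k km|H]; first by rewrite -nthm // E nth_word.
apply: (@eq_from_nth _ (v 0)) => [|k].
  by rewrite size_rev size_map !size_word.
by rewrite size_rev size_map size_word => km; rewrite nthm // H // nth_word.
Qed.

Lemma eq_wordP (T : Type) (u v : nat -> T) (i j m : nat) :
  word u i m = word v j m <-> (forall k, k < m -> u (i + k) = v (j + k)).
Proof.
split=> [E k km|H].
  by rewrite -(nth_word (v 0) u i km) E nth_word.
by apply: (@eq_from_nth _ (v 0)) => [|k]; rewrite !size_word // => km;
  rewrite !nth_word // H.
Qed.

Lemma mem_wordP (T : eqType) (u : nat -> T) (i m : nat) (a : T) :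
  reflect (exists t, [/\ i <= t, t < i + m & u t = a]) (a \in word u i m).
Proof.
apply: (iffP mapP) => [[k]|[t [it tm <-]]].
  by rewrite mem_iota => km ->; exists (i + k); split=> //; lia.
by exists (t - i); [rewrite mem_iota; lia | congr u; lia].
Qed.

Lemma infix_wordP (T : eqType) (u : nat -> T) (i m : nat) (p : seq T) :
  reflect (exists t, [/\ i <= t, t + size p <= i + m & p = word u t (size p)])
          (infix p (word u i m)).
Proof.
apply: (iffP (@infixP _ p (word u i m))) => [[s [s' E]]|[t [it tm pE]]].
  have mE : m = size s + (size p + size s').
    by rewrite -(size_word u i m) E !size_cat.
  exists (i + size s); split; [lia | lia |].
  move: E; rewrite {1}mE !word_cat => /eqP.
  rewrite eqseq_cat ?size_word // => /andP[_].
  by rewrite eqseq_cat ?size_word // => /andP[/eqP/esym].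
exists (word u i (t - i)), (word u (t + size p) (i + m - (t + size p))).
have {1}-> : m = t - i + (size p + (i + m - (t + size p))) by lia.
by rewrite !word_cat subnKC // -pE.
Qed.

Lemma suffix_word (T : eqType) (u : nat -> T) (i m : nat) (p : seq T) :
  suffix p (word u i m) ->
  size p <= m /\ p = word u (i + (m - size p)) (size p).
Proof.
move=> sp; have pm : size p <= m by rewrite -(size_word u i m) size_suffix.
split=> //; case/suffixP: sp => s E.
have mE : m = size s + size p by rewrite -(size_word u i m) E size_cat.
move: E; rewrite {1}mE word_cat => /eqP.
rewrite eqseq_cat ?size_word // => /andP[_ /eqP/esym pE].
by rewrite {1}pE; congr word; lia.
Qed.

(** * Recoding by overlapping blocks *)

Definition block (T : Type) (n : nat) (u : nat -> T) (i : nat) :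
  n.+1.-tuple T := Tuple (introT eqP (size_word u i n.+1)).

Definition tmirror (T : Type) (n : nat) (th : T -> T) (t : n.-tuple T) :
  n.-tuple T := rev_tuple (map_tuple th t).

Lemma tmirrorK (T : Type) (n : nat) (th : T -> T) :
  involutive th -> involutive (@tmirror T n th).
Proof. by move=> thK t; apply: val_inj; exact: mirrorK. Qed.

Lemma eq_blockP (T : Type) (n : nat) (u : nat -> T) (i j : nat) :
  block n u i = block n u j <-> (forall k, k <= n -> u (i + k) = u (j + k)).
Proof.
split=> [/(congr1 val)/eq_wordP H k kn|H]; first exact: H.
by apply: val_inj; apply/eq_wordP.
Qed.

Lemma block_mirrorP (T : Type) (th : T -> T) (n : nat) (u : nat -> T) (i j : nat) :
  tmirror th (block n u i) = block n u j <->
  (forall k, k <= n -> th (u (i + (n - k))) = u (j + k)).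
Proof.
split=> [/(congr1 val)/word_mirrorP H k kn|H]; first exact: H.
by apply: val_inj; apply/word_mirrorP.
Qed.

Lemma word_block (T : Type) (n : nat) (u : nat -> T) (i j m : nat) :
  word u i (m + n) = word u j (m + n) ->
  word (block n u) i m = word (block n u) j m.
Proof.
move=> /eq_wordP E; apply/eq_wordP => k km; apply/eq_blockP => l ln.
by rewrite -!addnA E //; lia.
Qed.

(** The case [m = 0] must be excluded: the empty block word does not determine the [n] letters on
    the right. *)
Lemma word_block_inj (T : Type) (n : nat) (u : nat -> T) (i j m : nat) :
  0 < m -> word (block n u) i m = word (block n u) j m ->
  word u i (m + n) = word u j (m + n).
Proof.
move=> m0 /eq_wordP E; apply/eq_wordP => k km.
(* Letter [k] is read in the block of index [minn k m.-1]: as first letter while [k < m], and inside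
   the last block afterwards. *)
have lm : minn k m.-1 < m by lia.
have /eq_blockP/(_ (k - minn k m.-1)) := E _ lm.
rewrite -!addnA (_ : minn k m.-1 + _ = k); last lia.
by apply; lia.
Qed.

Lemma mirror_word_block (T : Type) (th : T -> T) (n : nat) (u : nat -> T)
    (i j m : nat) :
  mirror th (word u i (m + n)) = word u j (m + n) ->
  mirror (tmirror th) (word (block n u) i m) = word (block n u) j m.
Proof.
move=> /word_mirrorP E; apply/word_mirrorP => k km.
apply/block_mirrorP => l ln; rewrite -[in RHS]addnA -E; last lia.
by congr (th (u _)); lia.
Qed.

(* In [u] read from [i0] up to any position past [i0 + n], the last letter is
   fresh or ends a new palindrome [p].  If [p] begins before the block word
   under study, then it contains an earlier mirror image of that word, whence
   the inner induction on the position. *)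
Lemma block_defect (A : finType) (th : A -> A) (u : nat -> A) (n i0 : nat) :
  involutive th ->
  (forall m, n <= m ->
     fresh th (word u i0 m) (u (i0 + m)) ||
     new_pal th (word u i0 m) (u (i0 + m))) ->
  forall m j, i0 <= j ->
    defect (mirror (tmirror th)) (word (block n u) j m) = 0%R.
Proof.
move=> thK step; elim=> [|m IHm] j; first by rewrite defect_nil.
elim/ltn_ind: j => j IHj ij.
have th2K := @tmirrorK A n.+1 th thK.
(* Either the block word mirrors one starting earlier, settled by [IHj], or its last letter leaves
   the defect unchanged, and [IHm] applies. *)
suff H : (exists2 s, i0 <= s < j &
           word (block n u) s m.+1 =
           mirror (tmirror th) (word (block n u) j m.+1)) \/
         fresh (tmirror th) (word (block n u) j m) (block n u (j + m)) ||
         new_pal (tmirror th) (word (block n u) j m) (block n u (j + m)).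
  case: H => [[s /andP[i0s sj] E]|H].
    by rewrite -defect_mirror // -E IHj.
  by rewrite word_rcons defect_rcons // IHm // H.
(* The position in [u] of the last letter of the last block. *)
set e := j + m + n.
have eE : i0 + (e - i0) = e by rewrite /e; lia.
have := step (e - i0); rewrite eE => /(_ ltac:(lia))/orP[].
  (* A last block that is its own mirror, or that occurs earlier directly or mirrored, would put
     [u e] or its image under [th] at an earlier position. *)
  case/and3P=> tha aw taw; right; apply/orP; left; apply/and3P; split.
  - apply/eqP => /block_mirrorP H.
    case/negP: taw; apply/mem_wordP; exists (j + m).
    have := H 0 (leq0n _); rewrite subn0 addn0 -/e => E.
    split=> //; first lia.
    have : j + m <> e by move=> jme; rewrite E jme eqxx in tha.
    by rewrite eE /e; lia.
  - apply/negP => /mem_wordP[t [jt tm /eq_blockP/(_ n (leqnn n)) E]].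
    case/negP: aw; apply/mem_wordP; exists (t + n).
    by split=> //; rewrite ?eE /e; lia.
  - apply/negP => /mem_wordP[t [jt tm /esym/block_mirrorP/(_ 0 (leq0n _))]].
    rewrite subn0 addn0 -/e => E.
    case/negP: taw; apply/mem_wordP; exists t.
    by split=> //; rewrite ?eE /e; lia.
case/new_palP=> p [pp]; rewrite -{2}eE -word_rcons => /suffix_word[].
set L := size p => pm; set s := _ + (_ - _) => pE np.
have sE : s + L = e.+1 by rewrite /s; lia.
have L0 : 0 < L by rewrite lt0n size_eq0; apply: contraNneq np => ->; rewrite infix0s.
(* [p] occupies positions [s] to [e], and no earlier occurrence starts at or after [i0]. *)
have np' t : i0 <= t -> t < s -> word u t L <> p.
  move=> it ts tE; case/negP: np; apply/infix_wordP; exists t.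
  by rewrite -/L tE eE; split=> //; lia.
move: pp; rewrite pE => ppal; rewrite pE in np'.
have pal := (word_mirrorP th u u s s L).1 ppal.
have i0s : i0 <= s by rewrite /s; lia.
(* If [p] starts before [j], reflection in [p] carries the stretch from [j] to [e] onto its prefix
   starting at [s]. *)
case: (ltnP s j) => [sj|js].
  left; exists s; first by rewrite i0s sj.
  apply/esym/mirror_word_block/word_mirrorP => k km.
  rewrite -pal; last by rewrite /e in sE; lia.
  by congr (th (u _)); rewrite /e in sE; lia.
(* A [p] longer than [n] recodes to a palindrome of [L - n] blocks; an earlier copy of that one
   would decode to an earlier [p]. *)
right; case: (ltnP n L) => [nL|Ln].
  apply/orP; right; apply/new_palP.
  have LE : L = (L - n) + n by lia.
  exists (word (block n u) s (L - n)); split.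
  - by apply: mirror_word_block; rewrite -LE.
  - rewrite -word_rcons.
    have -> : m.+1 = (s - j) + (L - n) by rewrite /e in sE; lia.
    rewrite word_cat (_ : j + (s - j) = s); last lia.
    exact: suffix_suffix.
  - apply/infix_wordP => -[t []]; rewrite size_word => jt tL E.
    apply: (np' t); [lia | rewrite /e in sE; lia |].
    by rewrite LE; apply/esym/word_block_inj => //; lia.
(* A short [p] lies inside the last block, which is then itself fresh. *)
have jms : j + m <= s by rewrite /e in sE; lia.
apply/orP; left.
(* [p] is a suffix of the last block, hence a prefix of its mirror image. *)
have nomir t : i0 <= t -> t < s ->
    tmirror th (block n u (j + m)) <> block n u t.
  move=> it ts /block_mirrorP E; apply: (np' t) => //.
  apply/eq_wordP => k kL; rewrite -E; last lia.
  rewrite -pal //; congr (th (u _)); rewrite /e in sE; lia.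
apply/and3P; split.
- by apply/eqP/nomir; rewrite /e in sE; lia.
- apply/negP => /mem_wordP[t [jt tm /eq_blockP E]].
  (* An earlier copy of the last block contains [p] at the same offset. *)
  apply: (np' (t + (s - (j + m)))); [lia | lia |].
  apply/eq_wordP => k kL; rewrite -addnA E; last by rewrite /e in sE; lia.
  by congr u; lia.
- apply/negP => /mem_wordP[t [jt tm /esym]].
  by apply: nomir; lia.
Qed.

(** * A factor of maximal defect, and the conclusion *)

Lemma max_defect (A : finType) (Th : seq A -> seq A) (u : nat -> A) :
  finite_defect Th u ->
  exists i m, forall i' m',
    (defect Th (word u i' m') <= defect Th (word u i m))%R.
Proof.
case=> C bound.
have fac i m : factor_of u (word u i m) by exists i; rewrite /occurs_at size_word.
(* Induction on the gap [k] to the bound: a non-maximal factor is replaced by one of larger defect,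
   which narrows the integer gap. *)
suff H k i m : (C - defect Th (word u i m) <= k%:Z)%R ->
    exists i m, forall i' m',
      (defect Th (word u i' m') <= defect Th (word u i m))%R.
  apply: (H `|C - defect Th (word u 0 0)|%N 0 0).
  by have := bound _ (fac 0 0); lia.
elim: k i m => [|k IHk] i m Ck.
  by exists i, m => i' m'; have := bound _ (fac i' m'); lia.
case: (classic (forall i' m',
    (defect Th (word u i' m') <= defect Th (word u i m))%R)).
  by exists i, m.
move=> /not_all_ex_not[i' /not_all_ex_not[m' /negP]].
by rewrite -ltNge => lt; apply: (IHk i' m'); lia.
Qed.

Lemma defect_ext (A : finType) (Th Th' : seq A -> seq A) :
  Th =1 Th' -> defect Th =1 defect Th'.
Proof.
move=> E w; rewrite /defect /npal /Gth.
rewrite (@eq_filter _ (is_pal Th) (is_pal Th')); last first.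
  by move=> x; rewrite /is_pal E.
rewrite (@eq_filter _ (fun a => [:: a] != Th [:: a])
                      (fun a => [:: a] != Th' [:: a])); last first.
  by move=> x; rewrite E.
rewrite (@eq_map _ _ (pairset Th) (pairset Th')) // => a.
by apply/setP => b; rewrite !inE E.
Qed.

Theorem theorem1 (A : finType) (Th1 : seq A -> seq A) (u : nat -> A) :
  involutive_antimorphism Th1 ->
  recurrent u ->
  finite_defect Th1 u ->
  exists (B : finType) (Th2 : seq B -> seq B) (phi : seq B -> seq A) (v : nat -> B),
    [/\ involutive_antimorphism Th2, morphism phi, recurrent v,
        image_eq phi v u & rich Th2 v].
Proof.
move=> /antimorphismE[th [thK ThE]] urec /max_defect[i0 [n maxn]].
have {}maxn i m : (defect (mirror th) (word u i m) <=
                   defect (mirror th) (word u i0 n))%R.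
  by rewrite -!(defect_ext ThE).
have vrec : recurrent (block n u).
  move=> w i; rewrite /occurs_at -/(word _ _ _) => wE N.
  have uw : occurs_at u (word u i (size w + n)) i.
    by rewrite /occurs_at size_word.
  have [j [Nj]] := urec _ _ uw N; rewrite /occurs_at size_word => E.
  by exists j; split=> //; rewrite {1}wE; apply: word_block.
exists (n.+1.-tuple A : finType), (mirror (tmirror th)), (map (@thead n A)),
  (block n u); split=> //.
- exact/mirror_antimorphism/tmirrorK.
- by move=> x y; rewrite map_cat.
- have img m : img_prefix (map (@thead n A)) (block n u) m = word u 0 m.
    rewrite /img_prefix /word; elim: (iota 0 m) => //= k s ->.
    by rewrite /thead (tnth_nth (u 0)) /= addn0.
  split=> [m|m]; first by rewrite img size_word.
  by exists m; rewrite img size_word.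
(* Recurrence moves any factor of the block word to a position past [i0], where [block_defect]
   applies. *)
move=> w [i wE]; have [j [ij]] := vrec _ _ wE i0.
rewrite /occurs_at => ->; apply: block_defect ij => // m nm.
(* Extending the maximal factor keeps the defect maximal, so a letter of neither kind would push it
   above the maximum. *)
have le : (defect (mirror th) (word u i0 n) <=
           defect (mirror th) (word u i0 m))%R.
  by rewrite -[m](subnKC nm) word_cat defect_catl.
apply: contraT => stuck; have := maxn i0 m.+1.
by rewrite word_rcons defect_rcons // stuck; lia.
Qed.
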